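(* Let $(E,C)$ be a separated graph. Then the set of isolated points of $\Omega(E,C)$ coincides with the set $\Omega^{\mathrm{iso}}$ of all (finite) Leavitt $(E,C)$-trees which do not admit exits. Moreover, the set $\Omega^{\mathrm{iso}}_0$ is the set of isolated points $z\in\Omega(E,C)$ with trivial isotropy.
   Context: Graphs and paths. A directed graph $E=(E^0,E^1,s,r)$ has arbitrary sets of vertices and edges and source/range maps $s,r$. A separated graph $(E,C)$ is a directed graph with $C=\bigsqcup_{v\in E^0}C_v$, where $C_v$ is a partition of $s^{-1}(v)$ into pairwise disjoint nonempty subsets ($C_v=\emptyset$ if $s^{-1}(v)=\emptyset$). For $e\in E^1$ let $e^{-1}$ be a formal inverse with $s(e^{-1})=r(e)$, $r(e^{-1})=s(e)$; $E^{-1}=\{e^{-1}\}$, $\hat E^1=E^1\cup E^{-1}$. A path is a vertex or a sequence $y_1\cdots y_n$ in $\hat E^1$ with $r(y_i)=s(y_{i+1})$; it is reduced if it has no subpath $xx^{-1}$, $x\in\hat E^1$. $\alpha\cdot\beta$ is the reduction of the concatenation $\alpha\beta$ when $r(\alpha)=s(\beta)$. $A^\downarrow$ is the set of prefixes of elements of $A$ (the vertex $s(\nu)$ is a prefix of $\nu$); lower subsets are those closed under prefixes; $[g]_1$ is the first letter of a nontrivial reduced path $g$. A $C$-separated path is a reduced path with no subpath $x^{-1}y$ with $x,y\in X$, $X\in C$. $\mathbb F_C(v)$ is the set of $C$-separated paths with source $v$; $\mathbb F_C=\bigsqcup_v\mathbb F_C(v)$. $\gamma,\nu\in\mathbb F_C(v)$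 are $C$-compatible if $\nu^{-1}\cdot\gamma\in\mathbb F_C$; a set is $C$-compatible if its elements are pairwise so. Each reduced path is uniquely $g=g_Lw$, where $g_L$ is $s(g)$ or a prefix of $g$ ending in an edge $e\in X\in C$ with $|X|>1$, and $w$ is a (possibly empty) product of elements of $E^{-1}$ and edges $x$ with $\{x\}\in C$. The space $\Omega(E,C)$ (Leavitt model). $\mathfrak F_L(v)$ is the set of all (possibly infinite) nonempty $C$-compatible lower subsets $Z$ of $\mathbb F_C(v)$ such that each $z\in Z$ extends (possibly trivially) to an element of $Z$ that does not end in $E^{-1}$ and does not end in an edge $e$ with $\{e\}\in C$; $\mathfrak F_L=\bigsqcup_v\mathfrak F_L(v)$. The finite members of $\mathfrak F_L$ are the Leavitt $(E,C)$-trees; their set is $\mathcal X_L$. $\mathcal N_L^{\mathrm{inf}}(v)$ (resp. $\mathcal N_L^{\mathrm{fin}}(v)$) is the set of $\gamma y\in\mathbb F_C(v)$ with $\gamma$ a (possibly empty) product of inverse edges and edges $e$ with $\{e\}\in C$, and $y\in X\in C$ with $|X|=\infty$ (resp. $1<|X|<\infty$). For $Z\in\mathfrak F_L$ and $\bullet\in\{\mathrm{inf},\mathrm{fin}\}$, $\mathcal N_L^\bullet(Z)=\{gg'\in\mathbb F_C: g\in Z,\ g'\in\mathcal N_L^\bullet(r(g)),\ g[g']_1\notin Z,\ Z\cup\{gg'\}^\downarrow\in\mathfrak F_L\}$; its elements are the infinite (resp. finite) exits of $Z$. $Z$ has no exits if $\mathcal N_L^{\mathrm{inf}}(Z)=\mathcal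 N_L^{\mathrm{fin}}(Z)=\emptyset$. $\Omega(E,C)=\{Z\in\mathfrak F_L:\mathcal N_L^{\mathrm{fin}}(Z)=\emptyset\}$, with topology having as basis of compact open sets the sets $\{Z\in\Omega(E,C):T\subseteq Z,\ F\cap Z=\emptyset\}$, with $T\in\mathcal X_L$ and $F\subseteq\mathcal N_L^{\mathrm{inf}}(T)$ finite. Partial action and isotropy. For a nonempty lower subset $Z\subseteq\mathbb F_C(v)$, $Z_L=\{z_L:z\in Z\}^\downarrow$. The free group $\mathbb F$ on $E^1$ acts partially on $\Omega(E,C)$: for nontrivial $g\in\mathbb F_C$, $\theta_g$ has domain $\{Z:(g^{-1})_L\in Z\}$ and $\theta_g(Z)=[g\cdot(Z\cup\{g^{-1}\}^\downarrow)]_L=[g\cdot Z\cup g^\downarrow]_L$; $\theta_1=\mathrm{id}$; other $\theta_g$ have empty domain. The isotropy of $Z$ is the subgroup of $\alpha\in\mathbb F$ with $Z\in\mathrm{dom}(\theta_\alpha)$ and $\theta_\alpha(Z)=Z$. A non-trivial $C$-separated path $\alpha$ is a closed path if $r(\alpha)=s(\alpha)$, and a cycle if moreover the concatenation $\alpha\alpha$ is a $C$-separated path. $\Omega^{\mathrm{iso}}$ is the set of Leavitt $(E,C)$-trees with no exits, and $\Omega^{\mathrm{iso}}_0$ is the set of $T\in\Omega^{\mathrm{iso}}$ such that there is no closed path $\alpha=\beta\gamma\beta^{-1}$ with $\gamma$ a cycle, $(\alpha^{-1})_L\in T$ and $(\alpha\cdot T\cup\alpha^\downarrow)_L=T$.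 *)

(* Defs.v *)
From HB Require Import structures.
From mathcomp Require Import all_boot.
From mathcomp Require Import all_classical topology.

Set Implicit Arguments.
Unset Strict Implicit.
Unset Printing Implicit Defensive.

Local Open Scope classical_set_scope.

Record sepGraph := SepGraph {
  vertex : Type;
  edge : Type;
  esrc : edge -> vertex;
  erng : edge -> vertex;
  part : vertex -> set (set edge);
  (* the members of [part v] are nonempty, pairwise disjoint and cover
     s^-1(v); in particular [part v] is empty when s^-1(v) is *)
  partP : forall v, partition (part v) id (esrc @^-1` [set v]) }.

Inductive letter (G : sepGraph) := Fwd of edge G | Bwd of edge G.

Section SeparatedGraph.
Variable G : sepGraph.

Definition Cblock : set (set (edge G)) := \bigcup_v part v.

Definition linv (a : letter G) : letter G :=
  match a with Fwd e => Bwd e | Bwd e => Fwd e end.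

Definition lsrc (a : letter G) : vertex G :=
  match a with Fwd e => esrc e | Bwd e => erng e end.

Definition lrng (a : letter G) : vertex G := lsrc (linv a).

(* A path is a pair (source, word); the source is only informative for the
   empty word, i.e. for a vertex. Well-formedness is [is_path]. *)
Definition gpath : Type := (vertex G * seq (letter G))%type.

Definition prng (p : gpath) : vertex G := last p.1 (map lrng p.2).

Fixpoint walk (v : vertex G) (w : seq (letter G)) : Prop :=
  if w is a :: w' then lsrc a = v /\ walk (lrng a) w' else True.

Definition is_path (p : gpath) : Prop := walk p.1 p.2.

Definition consecutive (w : seq (letter G)) (a b : letter G) : Prop :=
  exists u1 u2, w = u1 ++ [:: a, b & u2].

Definition reduced (w : seq (letter G)) : Prop :=
  forall a, ~ consecutive w a (linv a).

Definition push (a : letter G) (w : seq (letter G)) : seq (letter G) :=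
  if w is b :: w' then if `[< b = linv a >] then w' else a :: w else [:: a].

Definition reduce (w : seq (letter G)) : seq (letter G) := foldr push [::] w.

Definition winv (w : seq (letter G)) : seq (letter G) := rev (map linv w).

Definition pinv (p : gpath) : gpath := (prng p, winv p.2).

(* plain concatenation, meaningful when r(p) = s(q) *)
Definition pcat (p q : gpath) : gpath := (p.1, p.2 ++ q.2).

(* the reduced product p . q, meaningful when r(p) = s(q) *)
Definition pmul (p q : gpath) : gpath := (p.1, reduce (p.2 ++ q.2)).

Definition pprefix (p q : gpath) : Prop :=
  p.1 = q.1 /\ exists w, q.2 = p.2 ++ w.

Definition down (A : set gpath) : set gpath :=
  [set p | exists2 q, A q & pprefix p q].

Definition lower (A : set gpath) : Prop :=
  forall p q, A q -> pprefix p q -> A p.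

Definition Csep (p : gpath) : Prop :=
  [/\ is_path p, reduced p.2 &
      forall X x y, Cblock X -> X x -> X y ->
        ~ consecutive p.2 (Bwd x) (Fwd y)].

Definition FC (v : vertex G) : set gpath := [set p | p.1 = v /\ Csep p].

Definition Ccompatible (A : set gpath) : Prop :=
  forall p q, A p -> A q -> Csep (pmul (pinv q) p).

(* inverse edges, and edges e with {e} in C *)
Definition neutral (a : letter G) : Prop :=
  match a with Fwd e => Cblock [set e] | Bwd _ => True end.

Definition gt1 (X : set (edge G)) : Prop :=
  exists x y, [/\ X x, X y & x <> y].

Definition allneutral (w : seq (letter G)) : Prop :=
  foldr (fun a P => neutral a /\ P) True w.

(* removes the longest neutral suffix, see [LwordP] *)
Fixpoint Lword (w : seq (letter G)) : seq (letter G) :=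
  if w is a :: w' then
    if nilp (Lword w') && `[< neutral a >] then [::] else a :: Lword w'
  else [::].

Definition pL (p : gpath) : gpath := (p.1, Lword p.2).

Definition setL (Z : set gpath) : set gpath := down (pL @` Z).

Definition ends_neutral (p : gpath) : Prop :=
  exists u a, p.2 = rcons u a /\ neutral a.

Definition FL_at (v : vertex G) : set (set gpath) :=
  [set Z | [/\ Z !=set0, Z `<=` FC v, lower Z, Ccompatible Z &
    forall z, Z z -> exists z', [/\ Z z', pprefix z z' & ~ ends_neutral z']]].

Definition FL : set (set gpath) := \bigcup_v FL_at v.

Definition XL : set (set gpath) := [set Z | FL Z /\ finite_set Z].

Definition NLv (K : set (set (edge G))) (v : vertex G) : set gpath :=
  [set p | FC v p /\ exists u y X,
     [/\ p.2 = rcons u (Fwd y), allneutral u, Cblock X, X y & K X]].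

(* [take 1 g'.2] is the one-letter word of the first letter of g' *)
Definition exits (K : set (set (edge G))) (Z : set gpath) : set gpath :=
  [set p | exists g g', [/\ p = pcat g g' /\ Csep p, Z g, NLv K (prng g) g',
     ~ Z (g.1, g.2 ++ take 1 g'.2) & FL (Z `|` down [set p])]].

Definition NLinf : set gpath -> set gpath :=
  exits [set X | infinite_set X].

Definition NLfin : set gpath -> set gpath :=
  exits [set X | gt1 X /\ finite_set X].

Definition no_exits (Z : set gpath) : Prop := NLinf Z = set0 /\ NLfin Z = set0.

Record Omega := MkOmega {
  omega_set :> set gpath;
  omega_FL : FL omega_set;
  omega_fin : NLfin omega_set = set0 }.

(* the compact open sets of the basis; the index (T, F) ranges over
   [Omega_index], and the topology on [Omega] is the one with this basis *)
Definition Omega_basic (TF : set gpath * set gpath) : set Omega :=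
  [set Z : Omega | TF.1 `<=` Z /\ TF.2 `&` Z = set0].

Definition Omega_index : set (set gpath * set gpath) :=
  [set TF | [/\ XL TF.1, finite_set TF.2 & TF.2 `<=` NLinf TF.1]].

Definition OmegaIso : set (set gpath) := [set T | XL T /\ no_exits T].

Definition closed_path (p : gpath) : Prop :=
  [/\ p.2 <> [::], Csep p & prng p = p.1].

Definition cycle_path (p : gpath) : Prop :=
  closed_path p /\ Csep (pcat p p).

Definition OmegaIso0 : set (set gpath) :=
  [set T | OmegaIso T /\
    ~ exists alpha beta gamma : gpath,
      [/\ closed_path alpha, cycle_path gamma,
          is_path beta /\ prng beta = gamma.1,
          alpha = pcat (pcat beta gamma) (pinv beta) &
          T (pL (pinv alpha)) /\
          setL ((pmul alpha @` T) `|` down [set alpha]) = T]].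

(* The free group on [edge G], in the reduced-word model: the product is the
   reduction of the concatenation. *)
Record freeGroup := FreeGroup {
  fword :> seq (letter G);
  fwordP : reduced fword }.

Lemma freeGroup_eq (x y : freeGroup) : fword x = fword y -> x = y.
Proof.
case: x y => [u ru] [w rw] /= E; case: w / E rw => rw.
by rewrite (Prop_irrelevance ru rw).
Qed.

Lemma linvK : involutive linv. Proof. by case. Qed.

Lemma reduced_nil : reduced [::].
Proof. by move=> a [[|? ?] [? ?]]. Qed.

Lemma reduced_cons a w : reduced (a :: w) <->
  reduced w /\ (if w is b :: _ then b <> linv a else True).
Proof.
split=> [r|[r h] b [[|c u] [u' /= []]]].
- split=> [b [u [u' E]]|]; first by apply: (r b); exists (a :: u), u'; rewrite E.
  case: w r => // b w r E; apply: (r a); exists [::], w; by rewrite E.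
- by move=> ab E; move: h; rewrite E ab; apply.
- by move=> _ E; apply: (r b); exists u, u'.
Qed.

Lemma reduced_push a w : reduced w -> reduced (push a w).
Proof.
case: w => [|b w] r /=.
  by apply/reduced_cons.
case: asboolP => [_|h]; first by case/reduced_cons: r.
by apply/reduced_cons.
Qed.

Lemma reduced_foldr r u : reduced r -> reduced (foldr push r u).
Proof. by move=> rr; elim: u => //= a u; exact: reduced_push. Qed.

Lemma reduced_reduce w : reduced (reduce w).
Proof. by apply: reduced_foldr; exact: reduced_nil. Qed.

Lemma reduce_id w : reduced w -> reduce w = w.
Proof.
elim: w => //= a w IH /reduced_cons[r h]; rewrite -/(reduce w) IH //.
by case: w {IH r} h => //= b w h; case: asboolP.
Qed.

Lemma pushK a w : reduced w -> push a (push (linv a) w) = w.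
Proof.
case: w => [|b w] r /=; first by case: asboolP.
rewrite linvK; case: asboolP => [E|_] /=; last by case: asboolP.
move: r; rewrite E => /reduced_cons[_].
by case: w => //= c w; case: asboolP.
Qed.

Lemma foldr_reduce r u : reduced r -> foldr push r (reduce u) = foldr push r u.
Proof.
move=> rr; elim: u => //= a u <-; rewrite -/(reduce u).
case: (reduce u) => [|b w] //=; case: asboolP => [->|//].
by rewrite pushK //; exact: reduced_foldr.
Qed.

Lemma reduce_cat u w : reduce (u ++ w) = foldr push (reduce w) u.
Proof. by rewrite /reduce foldr_cat. Qed.

Lemma winvK : involutive winv.
Proof. by move=> w; rewrite /winv map_rev revK mapK //; exact: linvK. Qed.

Lemma reduced_winv w : reduced w -> reduced (winv w).
Proof.
move=> r a [u [u' E]]; apply: (r a).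
exists (winv u'), (winv u).
by rewrite -[w]winvK E /winv map_cat rev_cat /= !rev_cons linvK -!cats1 -!catA.
Qed.

Lemma reduce_winvl w : reduce (winv w ++ w) = [::].
Proof.
elim: w => //= a w IH.
rewrite /winv /= rev_cons -cats1 -catA reduce_cat /= -/(reduce w).
have:= pushK (linv a) (@reduced_reduce w); rewrite linvK => ->.
by rewrite -reduce_cat.
Qed.

Definition fg_one : freeGroup := FreeGroup reduced_nil.
Definition fg_mul (x y : freeGroup) : freeGroup :=
  FreeGroup (@reduced_reduce (x ++ y)).
Definition fg_inv (x : freeGroup) : freeGroup :=
  FreeGroup (reduced_winv (@fwordP x)).

Lemma fg_mulA : associative fg_mul.
Proof.
move=> x y z; apply: freeGroup_eq => /=.
rewrite [RHS]reduce_cat foldr_reduce; last exact: reduced_reduce.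
rewrite foldr_cat reduce_cat; congr foldr.
by rewrite -reduce_cat; exact/reduce_id/reduced_reduce.
Qed.

Lemma fg_mul1 : left_id fg_one fg_mul.
Proof. by move=> x; apply/freeGroup_eq/reduce_id/fwordP. Qed.

Lemma fg_mulr1 : right_id fg_one fg_mul.
Proof.
by move=> x; apply/freeGroup_eq; rewrite /= cats0; apply/reduce_id/fwordP.
Qed.

Lemma fg_mulV : left_inverse fg_one fg_inv fg_mul.
Proof. by move=> x; apply/freeGroup_eq/reduce_winvl. Qed.

Lemma fg_mulrV : right_inverse fg_one fg_inv fg_mul.
Proof.
move=> x; apply/freeGroup_eq; rewrite /= -[X in X ++ _]winvK.
exact: reduce_winvl.
Qed.

HB.instance Definition _ := gen_eqMixin freeGroup.
HB.instance Definition _ := gen_choiceMixin freeGroup.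
HB.instance Definition _ := isGroup.Build freeGroup
  fg_mulA fg_mul1 fg_mulr1 fg_mulV fg_mulrV.

(* A nonempty word is identified with the path starting at the source of its
   first letter; only words that are C-separated paths, and the empty word,
   act with nonempty domain. *)
Definition theta_dom (g : freeGroup) : set Omega :=
  match fword g with
  | [::] => setT
  | a :: w => let p : gpath := (lsrc a, a :: w) in
              [set Z : Omega | Csep p /\ omega_set Z (pL (pinv p))]
  end.

(* the underlying set of theta_g(Z); meaningful for Z in [theta_dom g] *)
Definition theta (g : freeGroup) (Z : Omega) : set gpath :=
  match fword g with
  | [::] => Z
  | a :: w => let p : gpath := (lsrc a, a :: w) in
              setL (pmul p @` (Z `|` down [set pinv p]))
  end.

Definition isotropy (Z : Omega) : set freeGroup :=
  [set g | theta_dom g Z /\ theta g Z = Z].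

Lemma LwordP (w : seq (letter G)) : exists u,
  [/\ w = Lword w ++ u, allneutral u &
      Lword w = [::] \/ exists w' e X,
        [/\ Lword w = rcons w' (Fwd e), Cblock X, X e & gt1 X]].
Proof.
have blk e : exists2 X, Cblock X & X e.
  have [c _ _] := partP (esrc e).
  have : (@esrc G @^-1` [set esrc e]) e by [].
  by rewrite -c => -[X pX Xe]; exists X => //; exists (esrc e).
elim: w => [|a w [u [Ew nu Lw]]]; first by exists [::]; split => //; left.
rewrite /=; case: nilP => [L0|Ln] /=.
  case: asboolP => [na|na].
    by exists (a :: w); split; [| split; rewrite // Ew L0|left].
  rewrite L0; exists u; split; [by rewrite {1}Ew L0|by []|right].
  case: a na => [e /= ne|e /(_ I)//].
  have [X CX Xe] := blk e; exists [::], e, X; split => //.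
  apply/not_existsP => h; apply: ne; suff <- : X = [set e] by [].
  apply/seteqP; split=> [y Xy|_ ->//]; apply: contrapT => yne.
  by apply: (h e); exists y; split => // E; apply: yne.
exists u; split; [by rewrite {1}Ew|by []|right].
case: Lw => [//|[w' [e [X [E CX Xe gX]]]]].
by exists (a :: w'), e, X; rewrite E.
Qed.

Lemma pprefix_refl p : pprefix p p.
Proof. by split=> //; exists [::]; rewrite cats0. Qed.

Lemma pprefix_trans p q r : pprefix p q -> pprefix q r -> pprefix p r.
Proof.
move=> [e1 [u E1]] [e2 [w E2]]; split; first by rewrite e1.
by exists (u ++ w); rewrite E2 E1 catA.
Qed.

Lemma downS (A B : set (gpath)) : lower B -> A `<=` B -> down A `<=` B.
Proof. by move=> lB AB p [q Aq pq]; apply: lB (AB _ Aq) pq. Qed.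

Lemma lower_down (A : set gpath) : lower (down A).
Proof. by move=> p q [r Ar qr] pq; exists r => //; apply: pprefix_trans qr. Qed.

Lemma infinite_not_neutral X y : Cblock X -> X y -> infinite_set X ->
  ~ neutral (Fwd y).
Proof.
move=> [v _ pX] Xy iX [v' _ py]; apply: iX.
have [cv tv _] := partP v; have [cv' _ _] := partP v'.
have E1 : esrc y = v.
  by have : (@esrc G @^-1` [set v]) y by rewrite -cv; exists X.
have E2 : esrc y = v'.
  by have : (@esrc G @^-1` [set v']) y by rewrite -cv'; exists [set y].
rewrite -E2 E1 in py.
have -> : X = [set y] by apply: (tv _ _ pX py); exists y.
exact: finite_set1.
Qed.

Lemma walk_cat v u w :
  walk v (u ++ w) <-> walk v u /\ walk (last v (map lrng u)) w.
Proof.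
elim: u v => [|a u IH] v //=; first by split=> [|[]].
by rewrite IH; tauto.
Qed.

Lemma consecutive_catr u w a b : consecutive w a b -> consecutive (u ++ w) a b.
Proof. by move=> [p [q ->]]; exists (u ++ p), q; rewrite catA. Qed.

Lemma Csep_suffix v u w : Csep (v, u ++ w) -> Csep (prng (v, u), w).
Proof.
move=> [/walk_cat[_ wk] r c]; split=> //=.
- by move=> a /(consecutive_catr u); exact: r.
- by move=> X x y CX Xx Xy /(consecutive_catr u); exact: c Xx Xy.
Qed.

Lemma allneutral_cat u w : allneutral (u ++ w) <-> allneutral u /\ allneutral w.
Proof.
rewrite /allneutral; elim: u => [|a u IH] /=; first by split=> [|[]].
by rewrite IH; tauto.
Qed.

Lemma FL_setU (T T' Z : set gpath) : FL T -> FL T' -> FL Z ->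
  T `<=` Z -> T' `<=` Z -> FL (T `|` T').
Proof.
move=> [v1 _ [n1 _ l1 _ e1]] [v2 _ [n2 _ l2 _ e2]] [v _ [_ sZ _ cZ _]] TZ T'Z.
exists v => //; split.
- by case: n1 => t ?; exists t; left.
- by move=> p [/TZ|/T'Z] /sZ.
- by move=> p q [Tq|Tq] pq; [left; apply: l1 pq|right; apply: l2 pq].
- by move=> p q [/TZ|/T'Z] Zp [/TZ|/T'Z] Zq; exact: cZ.
- move=> z [/e1|/e2] [z' [Tz' ? ?]]; exists z'; split=> //; by [left|right].
Qed.

(* an infinite exit of a tree T contained in U, but not in U, is an infinite
   exit of U as soon as it is compatible with U *)
Lemma NLinf_mono (T U : set gpath) f : T `<=` U -> FL U ->
  NLinf T f -> ~ U f -> FL (U `|` down [set f]) -> NLinf U f.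
Proof.
move=> TU FU [g [g' [[-> sf] Tg [[g'1 sg'] [u [y [X [Eg' nu CX Xy iX]]]]] _ _]]].
move=> Uf FUf.
have lU : lower U by case: FU => v _ [].
pose P n := `[< U (g.1, g.2 ++ take n g'.2) >].
have P0 : exists n, P n by exists 0; apply/asboolP; rewrite take0 cats0; apply: TU; case: (g) Tg.
have Pb n : P n -> n <= size g'.2.
  move/asboolP => h; rewrite leqNgt; apply/negP => /ltnW lt.
  by apply: Uf; rewrite take_oversize in h.
case: (ex_maxnP P0 Pb) => n /asboolP Pn maxn.
have ltn : n < size g'.2.
  rewrite ltnNge; apply/negP => le; apply: Uf.
  by rewrite take_oversize in Pn.
exists (g.1, g.2 ++ take n g'.2), (prng (g.1, g.2 ++ take n g'.2), drop n g'.2).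
rewrite Eg' size_rcons ltnS in ltn.
split=> //.
- by rewrite /pcat /= -catA cat_take_drop.
- split; first split=> //.
    by apply: Csep_suffix; rewrite -catA cat_take_drop.
  exists (drop n u), y, X; split=> //=.
    by rewrite Eg' -cats1 drop_cat ltn_neqAle ltn andbT;
       case: eqP => [->|_]; rewrite ?subnn ?drop_size -?cats1.
  by move: nu; rewrite -{1}(cat_take_drop n u) allneutral_cat => -[].
- move=> /= h; suff /maxn : P n.+1 by rewrite ltnn.
  apply/asboolP; move: h; rewrite -catA.
  by rewrite -[in X in _ -> X]addn1 takeD.
Qed.

Lemma NLinf_in_FL (T U Z : set gpath) f : FL U -> NLinf T f ->
  FL Z -> U `<=` Z -> Z f -> FL (U `|` down [set f]).
Proof.
move=> FU [g [g' [[Ef _] Tg [_ [u [y [X [Eg' nu CX Xy iX]]]]] _ _]]].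
move=> [v _ [_ sZ lZ cZ _]] UZ Zf.
have [v1 _ [n1 _ l1 _ e1]] := FU.
have fZ : down [set f] `<=` Z by apply: downS => // _ ->.
exists v => //; split.
- by case: n1 => t ?; exists t; left.
- by move=> p [/UZ|/fZ] /sZ.
- by move=> p q [Uq|fq] pq; [left; apply: l1 pq|right; apply: lower_down pq].
- by move=> p q [/UZ|/fZ] Zp [/UZ|/fZ] Zq; exact: cZ.
- move=> z [/e1[z' [Uz' ? ?]]|[_ -> zf]]; first by exists z'; split=> //; left.
  exists f; split=> //; first by right; exists f => //; exact: pprefix_refl.
  move=> [w [a [E na]]]; apply: (infinite_not_neutral CX Xy iX).
  move: E; rewrite Ef /= Eg' -rcons_cat => /rcons_inj[_ E].
  by rewrite -E in na.
Qed.

Lemma Omega_basic_cover : \bigcup_(i in Omega_index) Omega_basic i = setT.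
Proof.
apply/seteqP; split=> // Z _.
have [v _ [[z Zz] sZ lZ cZ eZ]] := omega_FL Z.
have Zv : omega_set Z (v, [::]).
  by apply: (lZ _ _ Zz); split; [case: (sZ _ Zz) => <-|exists z.2].
exists ([set (v, [::])], set0); last by split; [move=> _ ->|rewrite set0I].
split=> //=; split; last exact: finite_set1.
exists v => //; split.
- by exists (v, [::]).
- by move=> _ ->; apply: sZ.
- by move=> [a b] _ -> [/= -> [w /esym]]; case: b.
- by move=> _ _ -> ->; apply: cZ.
- move=> _ ->; exists (v, [::]); split=> //; first exact: pprefix_refl.
  by move=> [[|? ?] [? []]].
Qed.

Lemma Omega_basic_join i j (Z : Omega) : Omega_index i -> Omega_index j ->
  Omega_basic i Z -> Omega_basic j Z ->
  exists k, [/\ Omega_index k, Omega_basic k Z &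
    Omega_basic k `<=` Omega_basic i `&` Omega_basic j].
Proof.
case: i j => [T F] [T' F'] [/= [FT fT] fF sF] [/= [FT' fT'] fF' sF'].
move=> [/= TZ FZ] [/= T'Z F'Z].
pose U := T `|` T'.
have FU : FL U := FL_setU FT FT' (omega_FL Z) TZ T'Z.
have UZ : U `<=` Z by move=> p [/TZ|/T'Z].
have TU : T `<=` U by left.
have T'U : T' `<=` U by right.
exists (U, (F `|` F') `&` [set f | FL (U `|` down [set f])]); split.
- split=> /=; first by split=> //; rewrite finite_setU.
    by apply: finite_setIl; rewrite finite_setU.
  move=> f [[Ff|Ff] h]; [apply: (NLinf_mono TU)|apply: (NLinf_mono T'U)] => //.
  + exact: sF.
  + by move/UZ => Zf; suff : (F `&` Z) f by rewrite FZ.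
  + exact: sF'.
  + by move/UZ => Zf; suff : (F' `&` Z) f by rewrite F'Z.
- split=> //=; apply/seteqP; split=> // f [[[Ff|Ff] _] Zf].
  + by rewrite -FZ.
  + by rewrite -F'Z.
- move=> Y [/= UY FY]; split; split=> /=.
  + by move=> p /TU/UY.
  + apply/seteqP; split=> // f [Ff Yf]; rewrite -FY; split=> //; split; first by left.
    exact: (NLinf_in_FL FU (sF _ Ff) (omega_FL Y) UY).
  + by move=> p /T'U/UY.
  + apply/seteqP; split=> // f [Ff Yf]; rewrite -FY; split=> //; split; first by right.
    exact: (NLinf_in_FL FU (sF' _ Ff) (omega_FL Y) UY).
Qed.

HB.instance Definition _ := gen_eqMixin Omega.
HB.instance Definition _ := gen_choiceMixin Omega.
HB.instance Definition _ := isBaseTopological.Build Omega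
  Omega_basic_cover Omega_basic_join.

Lemma open_OmegaE (A : set Omega) : open A <->
  exists2 D, D `<=` Omega_index & \bigcup_(i in D) Omega_basic i = A.
Proof. by []. Qed.

End SeparatedGraph.

Arguments OmegaIso : clear implicits.
Arguments OmegaIso0 : clear implicits.

(* Main.v *)
(** Inside a lower set, compatibility says that no path [c] of the set continues
   with two distinct edges of one block. Hence the last edge [y] of an exit can be
   replaced by any other edge of its block, and the resulting exits are pairwise
   incompatible. Every [T] in F_L extends to a point of Omega by adding finite exits
   only, which never meets a prescribed finite set of infinite exits of [T].
   So if a basic open set given by [(T, F)] is a singleton, then [T] has no exits,
   [F] is empty and the point is [T]. Conversely, any point properly containing
   [T] contains an exit of [T].
   For the isotropy, an element fixing [Z] is a closed path b c b^-1 with [c]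
   cyclically reduced, and [c] is a cycle because Z contains alpha_L and
   (alpha^-1)_L, which are compatible. *)

From Pilot Require Import Defs.
From mathcomp Require Import all_boot.
From mathcomp Require Import all_classical topology.
(* restores [down] and [pinv], which the MathComp imports shadow *)
Import Pilot.Defs.

Set Implicit Arguments.
Unset Strict Implicit.
Unset Printing Implicit Defensive.

Local Open Scope classical_set_scope.

(** * Blocks of the partition and their edges *)

Lemma block_uniq {G : sepGraph} (X Y : set (edge G)) x :
  Cblock X -> Cblock Y -> X x -> Y x -> X = Y.
Proof.
move=> [v _ vX] [w _ wY] Xx Yx.
have [cv tv _] := partP v; have [cw _ _] := partP w.
have E1 : esrc x = v.
  by have : (@esrc G @^-1` [set v]) x by rewrite -cv; exists X.
have E2 : esrc x = w.
  by have : (@esrc G @^-1` [set w]) x by rewrite -cw; exists Y.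
by move: wY; rewrite -E2 E1 => vY; apply: (tv _ _ vX vY); exists x.
Qed.

Lemma block_src {G : sepGraph} (X : set (edge G)) x y :
  Cblock X -> X x -> X y -> esrc x = esrc y.
Proof.
move=> [v _ vX] Xx Xy; have [cv _ _] := partP v.
have E1 : (@esrc G @^-1` [set v]) x by rewrite -cv; exists X.
have E2 : (@esrc G @^-1` [set v]) y by rewrite -cv; exists X.
by rewrite E1 E2.
Qed.

Lemma block_not_neutral {G : sepGraph} (X : set (edge G)) y :
  Cblock X -> X y -> gt1 X -> ~ neutral (Fwd y).
Proof.
move=> CX Xy [a [b [Xa Xb ab]]] /= Cy; apply: ab.
have E : X = [set y] by apply: (@block_uniq _ _ _ y).
by move: Xa Xb; rewrite E => -> ->.
Qed.

Lemma infinite_gt1 {G : sepGraph} (X : set (edge G)) : infinite_set X -> gt1 X.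
Proof.
move=> iX; have [a Xa] := infinite_setN0 iX.
have [b [Xb ba]] := infinite_setN0 (infinite_setD iX (finite_set1 a)).
by exists a, b; split=> // ab; apply: ba.
Qed.

(** * Subwords, inverses and C-separation of concatenations *)

Lemma consecutive_catl {G : sepGraph} (u w : seq (letter G)) a b :
  consecutive u a b -> consecutive (u ++ w) a b.
Proof. by move=> [p [q ->]]; exists p, (q ++ w); rewrite -catA. Qed.

Lemma consecutive_cat {G : sepGraph} (u w : seq (letter G)) a b :
  consecutive (u ++ w) a b ->
  [\/ consecutive u a b, consecutive w a b |
      exists u' w', u = rcons u' a /\ w = b :: w'].
Proof.
elim: u => [|c u IH] /=; first by move=> h; apply: Or32.
move=> [[|d p] [q]] /= [].
- move=> <-; case: u {IH} => [|d u] /=; last first.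
    by move=> [<- _]; apply: Or31; exists [::], u.
  by move=> ->; apply: Or33; exists [::], q.
- move=> _ E; have /IH[[p' [q' ->]]|h|[u' [w' [-> ->]]]] :
    consecutive (u ++ w) a b by rewrite E; exists p, q.
  + by apply: Or31; exists (c :: p'), q'.
  + by apply: Or32.
  + by apply: Or33; exists (c :: u'), w'.
Qed.

Lemma winv_cat {G : sepGraph} (u w : seq (letter G)) :
  winv (u ++ w) = winv w ++ winv u.
Proof. by rewrite /winv map_cat rev_cat. Qed.

Lemma winv_cons {G : sepGraph} (a : letter G) w :
  winv (a :: w) = rcons (winv w) (linv a).
Proof. by rewrite /winv /= rev_cons. Qed.

Lemma winv_rcons {G : sepGraph} (a : letter G) w :
  winv (rcons w a) = linv a :: winv w.
Proof. by rewrite -cats1 winv_cat. Qed.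

Lemma consecutive_winv {G : sepGraph} (w : seq (letter G)) a b :
  consecutive (winv w) a b -> consecutive w (linv b) (linv a).
Proof.
move=> [u [u' E]]; exists (winv u'), (winv u).
by rewrite -[w]winvK E winv_cat !winv_cons -!cats1 -!catA.
Qed.

Lemma prng_cat {G : sepGraph} (v : vertex G) u w :
  prng (v, u ++ w) = prng (prng (v, u), w).
Proof. by rewrite /prng /= map_cat last_cat. Qed.

Lemma walk_winv {G : sepGraph} (v : vertex G) w : walk v w ->
  walk (prng (v, w)) (winv w) /\ prng (prng (v, w), winv w) = v.
Proof.
elim: w v => //= a w IH v [<- /IH[w1 E]].
have -> : prng (lsrc a, a :: w) = prng (lrng a, w) by [].
rewrite winv_cons -cats1 prng_cat E; split; last by rewrite /prng /= /lrng linvK.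
by apply/walk_cat; split; last by split=> //; rewrite -/(prng (_, _)) E.
Qed.

Lemma Csep_prefix {G : sepGraph} (v : vertex G) u w :
  Csep (v, u ++ w) -> Csep (v, u).
Proof.
move=> [/walk_cat[wk _] r c]; split=> //=.
- by move=> a /(consecutive_catl w); exact: r.
- by move=> X x y CX Xx Xy /(consecutive_catl w); exact: c Xx Xy.
Qed.

Lemma Csep_winv {G : sepGraph} (v : vertex G) w :
  Csep (v, w) -> Csep (prng (v, w), winv w).
Proof.
move=> [/= wk r c]; split; first by have [] := walk_winv wk.
- exact: reduced_winv.
- by move=> X x y CX Xx Xy /consecutive_winv; exact: c Xy Xx.
Qed.

Lemma Csep_cat {G : sepGraph} (v : vertex G) u w :
  Csep (v, u) -> Csep (prng (v, u), w) ->
  (forall u' a b w', u = rcons u' a -> w = b :: w' ->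
     b <> linv a /\ forall X x y, Cblock X -> X x -> X y ->
       a = Bwd x -> b <> Fwd y) ->
  Csep (v, u ++ w).
Proof.
move=> [wu ru cu] [ww rw cw] j; split.
- by apply/walk_cat.
- move=> a /consecutive_cat[/ru|/rw|[u' [w' [Eu Ew]]]] //.
  by have [] := j _ _ _ _ Eu Ew.
- move=> X x y CX Xx Xy
    /consecutive_cat[/(cu _ _ _ CX Xx Xy)|/(cw _ _ _ CX Xx Xy)|] //.
  by move=> [u' [w' [Eu Ew]]]; have [_ /(_ X x y)] := j _ _ _ _ Eu Ew; apply.
Qed.

(** The last edge is constrained only through its source and its block: a letter [Bwd x] with [x] in
    [X] is already excluded just before [y], and this also rules out backtracking at [y']. *)
Lemma Csep_sibling {G : sepGraph} (v : vertex G) w X y y' :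
  Csep (v, rcons w (Fwd y)) -> Cblock X -> X y -> X y' ->
  Csep (v, rcons w (Fwd y')).
Proof.
rewrite -!cats1 => s CX Xy Xy'; apply: Csep_cat.
- exact: Csep_prefix s.
- have [/walk_cat[_ /= [E _]] _ _] := s.
  split=> /=.
  + by split=> //; rewrite [RHS](esym E) /=; apply: (block_src CX).
  + by move=> a [[|? [|? ?]] [? []]].
  + by move=> Y a b _ _ _ [[|? [|? ?]] [? []]].
- case: s => _ _ c w' a b _ Ew [<- _].
  have {}c Y x z (CY : Cblock Y) (Yx : Y x) (Yz : Y z) : a = Bwd x -> y <> z.
    move=> Ea yz; apply: (c Y x z) => //=; exists w', [::].
    by rewrite Ew -cats1 -catA Ea yz.
  split.
  + case: a {Ew} c => //= x c [Ex].
    by apply: (c X x y CX _ Xy) => //; rewrite -Ex.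
  + move=> Y x z CY Yx Yz Ea [Ez]; subst z.
    have YX : Y = X by apply: (block_uniq (x := y')).
    by subst Y; apply: (c X x y).
Qed.

(** * Longest common prefixes, forks and compatibility *)

Definition heads_differ {T : Type} (p q : seq T) : Prop :=
  match p, q with a :: _, b :: _ => a <> b | _, _ => True end.

Lemma lcp {T : Type} (p q : seq T) : exists c p' q',
  [/\ p = c ++ p', q = c ++ q' & heads_differ p' q'].
Proof.
elim: p q => [|a p IH] [|b q]; try by exists [::]; do 2 eexists; split.
have [<-|ab] := pselect (a = b).
  by have [c [p' [q' [-> -> h]]]] := IH q; exists (a :: c), p', q'.
by exists [::], (a :: p), (b :: q).
Qed.

Lemma reduce_catV {G : sepGraph} (u w z : seq (letter G)) :
  reduce (u ++ winv w ++ w ++ z) = reduce (u ++ z).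
Proof.
have h := @reduced_reduce _ z.
rewrite reduce_cat [in RHS]reduce_cat; congr foldr.
by rewrite catA reduce_cat -(foldr_reduce _ h) reduce_winvl.
Qed.

(** The common prefix cancels, and distinct heads leave nothing to cancel at the junction. *)
Lemma reduce_winv_cat {G : sepGraph} (c p q : seq (letter G)) :
  reduced p -> reduced q -> heads_differ p q ->
  reduce (winv (c ++ q) ++ c ++ p) = winv q ++ p.
Proof.
move=> rp rq h; rewrite winv_cat -catA reduce_catV; apply: reduce_id.
move=> a /consecutive_cat[|/rp//|[u' [w' [Eq Ep]]]].
  exact: reduced_winv.
move: h; rewrite -[q]winvK Eq Ep winv_rcons /=; exact.
Qed.

Definition fork {G : sepGraph} (p q : seq (letter G)) : Prop :=
  exists c X x y p' q', [/\ Cblock X, X x, X y, x <> y &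
    p = c ++ Fwd x :: p' /\ q = c ++ Fwd y :: q'].

Lemma reduced_catr {G : sepGraph} (u w : seq (letter G)) :
  reduced (u ++ w) -> reduced w.
Proof. by move=> r a /(consecutive_catr u); exact: r. Qed.

(** Without the longest common prefix, the product is q'^-1 p'. Both factors are C-separated, so
    only the junction can fail, and it does so exactly when the first letters are distinct edges of
    one block. *)
Lemma compatE {G : sepGraph} (v : vertex G) p q :
  Csep (v, p) -> Csep (v, q) ->
  Csep (pmul (pinv (v, q)) (v, p)) <-> ~ fork p q.
Proof.
move=> sp sq; rewrite /pmul /=; split.
- move=> [_ _ /= h] [c [X [x [y [p' [q' [CX Xx Xy xy [Ep Eq]]]]]]]].
  case: sp sq => [_ rp _] [_ rq _]; rewrite /= in rp rq.
  move: (h X y x CX Xy Xx); subst p q; apply.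
  rewrite reduce_winv_cat; [|exact: reduced_catr rp|exact: reduced_catr rq|by case].
  by exists (winv q'), p'; rewrite winv_cons -cats1 -catA.
- move=> nf; have [c [p' [q' [Ep Eq h]]]] := lcp p q; subst p q.
  case: (sp) (sq) => [_ /= rp _] [_ /= rq _].
  rewrite reduce_winv_cat //; [|exact: reduced_catr rp|exact: reduced_catr rq].
  have s1 : Csep (prng (v, c ++ q'), winv q').
    by have := Csep_winv sq; rewrite winv_cat; apply: Csep_prefix.
  apply: Csep_cat => //.
    have -> : prng (prng (v, c ++ q'), winv q') = prng (v, c).
      case: sq => /walk_cat[_ wq] _ _; rewrite prng_cat.
      by have [] := walk_winv wq.
    exact: Csep_suffix sp.
  move=> u' a b w' Eu Ew; move: h nf; rewrite -[q']winvK Eu winv_rcons Ew /= => h nf.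
  split=> // X x y CX Xx Xy Ea Eb; subst a b; apply: nf.
  exists c, X, y, x, w', (winv u'); split=> // E; apply: h; by rewrite E.
Qed.

Lemma pprefixP {G : sepGraph} (p q : gpath G) :
  pprefix p q <-> exists w, q = (p.1, p.2 ++ w).
Proof.
case: p q => [a p] [b q]; split=> [[/= -> [w ->]]|[w [-> ->]]]; first by exists w.
by split=> //; exists w.
Qed.

Definition forkfree {G : sepGraph} (v : vertex G) (Z : set (gpath G)) : Prop :=
  forall c X x y, Cblock X -> X x -> X y ->
    Z (v, rcons c (Fwd x)) -> Z (v, rcons c (Fwd y)) -> x = y.

(** A lower set contains the prefixes that end right at a fork, so it suffices to test pairs of
    paths that differ in their last edge. *)
Lemma forkfreeE {G : sepGraph} (v : vertex G) Z : Z `<=` FC v -> lower Z ->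
  Ccompatible Z <-> forkfree v Z.
Proof.
move=> sZ lZ; split.
- move=> cZ c X x y CX Xx Xy Zx Zy; apply: contrapT => xy.
  have [_ sx] := sZ _ Zx; have [_ sy] := sZ _ Zy.
  apply: (proj1 (compatE sx sy)); first exact: cZ.
  by exists c, X, x, y, [::], [::]; rewrite -!cats1.
- move=> fZ [v1 p] [v2 q] Zp Zq.
  have [/= Ep sp] := sZ _ Zp; have [/= Eq sq] := sZ _ Zq; subst v1 v2.
  apply/(compatE sp sq) => -[c [X [x [y [p' [q' [CX Xx Xy xy [Ep Eq]]]]]]]].
  apply: xy; apply: (fZ c X) => //.
  + by apply: (lZ _ _ Zp); apply/pprefixP; exists p'; rewrite Ep cat_rcons.
  + by apply: (lZ _ _ Zq); apply/pprefixP; exists q'; rewrite Eq cat_rcons.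
Qed.

(** * Members of F_L and their exits *)

Lemma FL_atE {G : sepGraph} (v : vertex G) Z : FL_at v Z <->
  [/\ Z (v, [::]), Z `<=` FC v, lower Z, forkfree v Z &
    forall z, Z z -> exists z', [/\ Z z', pprefix z z' & ~ ends_neutral z']].
Proof.
split=> [[[[w z] Zz] sZ lZ cZ eZ]|[Zv sZ lZ fZ eZ]].
- split=> //; last exact/forkfreeE.
  have [/= wv _] := sZ _ Zz; subst w.
  by apply: (lZ _ _ Zz); apply/pprefixP; exists z.
- by split=> //; [exists (v, [::])|apply/(forkfreeE sZ)].
Qed.

Lemma FL_at_FL {G : sepGraph} (v : vertex G) Z p : FL Z -> Z p -> p.1 = v ->
  FL_at v Z.
Proof.
move=> [w _ FZ] Zp <-; have [_ /(_ _ Zp) [-> _] _ _ _] := FZ; exact: FZ.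
Qed.

(* An exit of [T] at [g], with the paths of the definition split into words:
   it leaves [T] right after [g], and [y] is its only non-neutral new edge. *)
Definition exit_at {G : sepGraph} (v : vertex G) (T : set (gpath G)) g u y :=
  [/\ T (v, g), allneutral u, ~ T (v, g ++ take 1 (rcons u (Fwd y))) &
     Csep (v, g ++ rcons u (Fwd y)) /\
     FL_at v (T `|` down [set (v, g ++ rcons u (Fwd y))])].

Lemma exitsP {G : sepGraph} K (v : vertex G) T p : FL_at v T ->
  exits K T p <-> exists g u y X,
    [/\ Cblock X, X y, K X, p = (v, g ++ rcons u (Fwd y)) & exit_at v T g u y].
Proof.
move=> FT; split.
- move=> [[w g] [g' [[-> sp] Tg [_ [u [y [X [Eg' nu CX Xy KX]]]]] nT FU]]].
  have [_ /(_ _ Tg) [/= wv _] _ _ _] := FT; subst w.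
  rewrite /pcat /= Eg' in sp nT FU *.
  exists g, u, y, X; split=> //; split=> //; split=> //.
  by apply: (FL_at_FL (p := (v, g)) FU) => //; left.
- move=> [g [u [y [X [CX Xy KX -> [Tg nu nT [sp FU]]]]]]].
  exists (v, g), (prng (v, g), rcons u (Fwd y)); split=> //.
  + split; first by split=> //; exact: Csep_suffix sp.
    by exists u, y, X.
  + by exists v.
Qed.

Lemma neutral_suffix {G : sepGraph} (v : vertex G) w u :
  u <> [::] -> allneutral u -> ends_neutral (v, w ++ u).
Proof.
case: (lastP u) => // u' a _; rewrite -cats1 allneutral_cat => -[_ [na _]].
by exists (w ++ u'), a; rewrite /= -cats1 catA.
Qed.

Lemma rcons_eq_cat {T : Type} (w f z : seq T) y :
  rcons w y = f ++ z -> f = rcons w y \/ exists z', w = f ++ z'.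
Proof.
case: (lastP z) => [|z' a]; first by rewrite cats0 => ->; left.
by rewrite -rcons_cat => /rcons_inj[-> _]; right; exists z'.
Qed.

Lemma cat_eq_cat {T : Type} (w u f z : seq T) : w ++ u = f ++ z ->
  (exists z', w = f ++ z') \/ exists f' z', [/\ f = w ++ f', u = f' ++ z' & f' <> [::]].
Proof.
elim: w f => [|a w IH] [|b f] /=; try by left; exists (a :: w).
- by left; exists [::].
- by move=> ->; right; exists (b :: f), z.
- move=> [-> /IH[[z' ->]|[f' [z' [-> -> h]]]]]; first by left; exists z'.
  by right; exists f', z'.
Qed.

(** The letters between [g] and the final edge are neutral, so the exit itself is the only new path
    that can end in a non-neutral letter. *)
Lemma exit_prefix {G : sepGraph} (v : vertex G) g u y f : allneutral u ->
  pprefix f (v, g ++ rcons u (Fwd y)) ->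
  [\/ pprefix f (v, g), ends_neutral f | f = (v, g ++ rcons u (Fwd y))].
Proof.
case: f => w f nu /pprefixP /= [z [-> ]]; rewrite -rcons_cat.
move=> E; case: (rcons_eq_cat E) => [->|[z' /cat_eq_cat[[z2 ->]|]]].
- exact: Or33.
- by apply: Or31; apply/pprefixP; exists z2.
- move=> [f' [z2 [-> Eu h]]]; apply: Or32; apply: neutral_suffix => //.
  by move: nu; rewrite Eu allneutral_cat => -[].
Qed.

Lemma ends_neutral_Fwd {G : sepGraph} (v : vertex G) w X y :
  Cblock X -> X y -> gt1 X -> ~ ends_neutral (v, rcons w (Fwd y)).
Proof.
move=> CX Xy gX [u [a [/= /rcons_inj[_ <-] na]]].
exact: (block_not_neutral CX Xy gX).
Qed.

Lemma exit_notin {G : sepGraph} (v : vertex G) T g u y : lower T ->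
  exit_at v T g u y -> ~ T (v, g ++ rcons u (Fwd y)).
Proof.
move=> lT [_ _ nT _] Tf; apply: nT; apply: (lT _ _ Tf); apply/pprefixP.
by exists (drop 1 (rcons u (Fwd y))); rewrite /= -catA cat_take_drop.
Qed.

Lemma down1 {G : sepGraph} (p q : gpath G) : pprefix q p -> down [set p] q.
Proof. by exists p. Qed.

(** A fork of the new path with [T] before the last edge would already be a fork of the old exit. A
    fork at the last edge needs an edge of [X] after [g ++ u] in [T]; compatibility with the old
    exit makes that edge [y], which is not there. *)
Lemma exit_sibling {G : sepGraph} (v : vertex G) T g u X y y' :
  FL_at v T -> Cblock X -> gt1 X -> X y -> X y' ->
  exit_at v T g u y -> exit_at v T g u y'.
Proof.
move=> FT CX gX Xy Xy' xy.
have [<-//|yy'] := pselect (y = y').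
have /FL_atE[Tv sT lT fT eT] := FT.
have nTy := exit_notin lT xy.
case: xy => Tg nu nT [sy FUy].
have /FL_atE[_ sU lU fU _] := FUy.
have Uy : (T `|` down [set (v, g ++ rcons u (Fwd y))]) (v, rcons (g ++ u) (Fwd y)).
  by right; rewrite rcons_cat; exact/down1/pprefix_refl.
have nTy' : ~ T (v, rcons (g ++ u) (Fwd y')).
  move=> Ty'; apply: yy'; apply: (fU (g ++ u) X) => //; by left.
have sy' : Csep (v, g ++ rcons u (Fwd y')).
  by rewrite -rcons_cat; apply: (Csep_sibling (X := X) (y := y)) => //; rewrite rcons_cat.
have clash c x z Y : Cblock Y -> Y x -> Y z -> T (v, rcons c (Fwd x)) ->
    down [set (v, g ++ rcons u (Fwd y'))] (v, rcons c (Fwd z)) -> x = z.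
  move=> CY Yx Yz Tx [_ ->] /pprefixP[/= w [Ew]]; move: Ew; rewrite -rcons_cat.
  move=> E; case: (rcons_eq_cat E) => [/rcons_inj[Ec [Ez]]|[w' Ew]].
    subst c z; have YX : Y = X by apply: (block_uniq (x := y')).
    subst Y; exfalso; apply: nTy; suff <- : x = y by rewrite -rcons_cat.
    by apply: (fU (g ++ u) X) => //; left.
  apply: (fU c Y) => //; first by left.
  right; apply: down1; apply/pprefixP; exists (rcons w' (Fwd y)).
  by rewrite -rcons_cat Ew rcons_cat.
split=> //.
(* The first new letter changes only if [u] is empty; it is then [y']. *)
- by move: nT nTy'; rewrite rcons_cat; case: (u) => [|a u'] //=; rewrite !take0.
- split=> //; apply/FL_atE; split; first by left.
  + move=> p [/sT//|[_ -> /pprefixP[w [Ev E]]]]; split=> //.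
    by rewrite (surjective_pairing p) -Ev; apply: (Csep_prefix (w := w)); rewrite -E.
  + move=> p q [Tq|fq] pq; [left; exact: lT pq|right; exact: lower_down pq].
  + move=> c Y x z CY Yx Yz [Tx|fx] [Tz|fz].
    * exact: (fT c Y).
    * exact: (clash c x z Y).
    * by apply/esym; exact: (clash c z x Y).
    * case: fx => _ -> /pprefixP[/= w1 [E1]]; case: fz => _ -> /pprefixP[/= w2 [E2]].
      move: E2; rewrite E1 !cat_rcons => /(congr1 (drop (size c))).
      by rewrite !drop_size_cat // => -[].
  + move=> z [/eT[z' [Tz' zz' nz']]|[_ -> zf]].
      by exists z'; split=> //; left.
    exists (v, g ++ rcons u (Fwd y')); split=> //.
      by right; exact/down1/pprefix_refl.
    by rewrite -rcons_cat; exact: (ends_neutral_Fwd CX Xy' gX).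
Qed.

Lemma nonneutral_split {G : sepGraph} (h : seq (letter G)) : allneutral h \/
  exists u y X r, [/\ h = u ++ Fwd y :: r, allneutral u, Cblock X, X y & gt1 X].
Proof.
elim: h => [|a h [nh|[u [y [X [r [-> nu CX Xy gX]]]]]]]; first by left.
- have [na|na] := pselect (neutral a); first by left.
  (* On a one-letter word, [LwordP] supplies the block of a non-neutral letter. *)
  have [u [E nu L]] := LwordP [:: a]; move: E nu L.
  rewrite /= asboolF //= => -[<-] _ [//|[w' [y [X [Ew CX Xy gX]]]]].
  right; exists [::], y, X, h; split=> //=.
  by move: Ew; rewrite -(cat0s [:: a]) cats1 => /rcons_inj[_ ->].
- have [na|na] := pselect (neutral a).
    by right; exists (a :: u), y, X, r.
  have [u' [E nu' L]] := LwordP [:: a]; move: E nu' L.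
  rewrite /= asboolF //= => -[<-] _ [//|[w' [z [Y [Ew CY Yz gY]]]]].
  right; exists [::], z, Y, (u ++ Fwd y :: r); split=> //=.
  by move: Ew; rewrite -(cat0s [:: a]) cats1 => /rcons_inj[_ ->].
Qed.

Lemma FL_add {G : sepGraph} (v : vertex G) T Z f :
  FL_at v T -> FL_at v Z -> T `<=` Z -> Z f -> ~ ends_neutral f ->
  FL_at v (T `|` down [set f]).
Proof.
move=> /FL_atE[Tv _ lT _ eT] /FL_atE[_ sZ lZ fZ _] TZ Zf nf.
have UZ : T `|` down [set f] `<=` Z.
  by move=> p [/TZ//|]; apply: downS => // _ ->.
apply/FL_atE; split; first by left.
- by move=> p /UZ/sZ.
- by move=> p q [Tq|fq] pq; [left; exact: lT pq|right; exact: lower_down pq].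
- by move=> c X x y CX Xx Xy /UZ Zx /UZ Zy; exact: (fZ c X).
- move=> z [/eT[z' [Tz' ? ?]]|[_ -> zf]]; first by exists z'; split=> //; left.
  by exists f; split=> //; right; exact/down1/pprefix_refl.
Qed.

(** Some path [w] of [Z] extends [p] and does not end in a neutral letter. The exit leaves [T] after
    the longest prefix of [w] in [T] and stops at the next non-neutral letter. *)
Lemma exit_exists {G : sepGraph} (v : vertex G) T Z p :
  FL_at v T -> FL_at v Z -> T `<=` Z -> Z p -> ~ T p ->
  exists g u y X, [/\ Cblock X, X y, gt1 X & exit_at v T g u y].
Proof.
move=> FT FZ TZ Zp nTp.
have /FL_atE[Tv _ lT _ _] := FT; have /FL_atE[_ sZ lZ _ eZ] := FZ.
have [[v' w] [Zw pw nw]] := eZ _ Zp.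
have [/= vv sw] := sZ _ Zw; subst v'.
have nTw : ~ T (v, w) by move=> Tw; apply: nTp; exact: lT pw.
have P0 : exists n, `[< T (v, take n w) >] by exists 0; rewrite take0; apply/asboolP.
have Pb n : `[< T (v, take n w) >] -> n <= size w.
  move/asboolP => h; rewrite leqNgt; apply/negP => /ltnW lt.
  by rewrite take_oversize in h.
case: (ex_maxnP P0 Pb) => n /asboolP Tn maxn.
have ltn : n < size w.
  rewrite ltnNge; apply/negP => le; apply: nTw.
  by rewrite take_oversize in Tn.
have [nd|[u [y [X [r [Er nu CX Xy gX]]]]]] := nonneutral_split (drop n w).
  exfalso; apply: nw; rewrite -(cat_take_drop n w); apply: neutral_suffix => //.
  by move/(congr1 size); rewrite size_drop /= => /eqP; rewrite subn_eq0 leqNgt ltn.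
have Zf : Z (v, take n w ++ rcons u (Fwd y)).
  apply: (lZ _ _ Zw); apply/pprefixP; exists r.
  by rewrite /= -catA cat_rcons -Er cat_take_drop.
exists (take n w), u, y, X; split=> //; split=> //.
- have -> : take 1 (rcons u (Fwd y)) = take 1 (drop n w).
    by rewrite Er -cat_rcons; case: (u) => [|? ?] /=; rewrite !take0.
  rewrite -takeD addn1 => Tn1; have := maxn n.+1; rewrite ltnn.
  by move=> h; apply/negP/h/asboolP.
- have [_ sf] := sZ _ Zf; split=> //; apply: (FL_add FT FZ) => //.
  by rewrite -rcons_cat; exact: (ends_neutral_Fwd CX Xy gX).
Qed.

(** * Extending a member of F_L to a point of Omega *)

(** A fork involves only two paths, and along a chain the new ones among them lie in a single member
    [W]. *)
Lemma FL_at_setU_bigcup {G : sepGraph} (v : vertex G) T (F : set (set (gpath G))) :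
  FL_at v T -> total_on F subset -> (forall W, F W -> FL_at v (T `|` W)) ->
  FL_at v (T `|` \bigcup_(W in F) W).
Proof.
move=> FT tF FW; have /FL_atE[Tv sT lT fT eT] := FT.
have {}FW W (FWW : F W) := proj1 (FL_atE _ _) (FW W FWW).
have inU W : F W -> T `|` W `<=` T `|` \bigcup_(W in F) W.
  by move=> FWW p [Tp|Wp]; [left|right; exists W].
apply/FL_atE; split; first by left.
- move=> p [/sT//|[W FWW Wp]]; have [_ sW _ _ _] := FW _ FWW.
  by apply: sW; right.
- move=> p q [Tq|[W FWW Wq]] pq; first by left; exact: lT pq.
  have [_ _ lW _ _] := FW _ FWW; apply: (inU W FWW).
  by apply: lW pq; right.
- move=> c X x y CX Xx Xy.
  have ff W : F W -> (T `|` W) (v, rcons c (Fwd x)) ->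
      (T `|` W) (v, rcons c (Fwd y)) -> x = y.
    by move=> FWW; have [_ _ _ fW _] := FW _ FWW; exact: (fW c X).
  move=> [Tx|[W FWW Wx]] [Ty|[W' FWW' Wy]].
  + exact: (fT c X).
  + by apply: (ff W' FWW'); [left|right].
  + by apply: (ff W FWW); [right|left].
  + have [WW'|W'W] := tF _ _ FWW FWW'.
      by apply: (ff W' FWW'); right=> //; exact: WW'.
    by apply: (ff W FWW); right=> //; exact: W'W.
- move=> z [/eT[z' [Tz' ? ?]]|[W FWW Wz]]; first by exists z'; split=> //; left.
  have [_ _ _ _ eW] := FW _ FWW.
  have [|z' [Wz' ? ?]] := eW z; first by right.
  by exists z'; split=> //; exact: (inU W).
Qed.

(** All infinite exits have this form, so an extension that adds no such path adds no prescribed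
    infinite exit. *)
Definition infinite_edge_ended {G : sepGraph} : set (gpath G) :=
  [set p | exists w y X, [/\ p.2 = rcons w (Fwd y), Cblock X, X y & infinite_set X]].

Lemma infinite_edge_ended_neutral {G : sepGraph} (p : gpath G) :
  infinite_edge_ended p -> ~ ends_neutral p.
Proof.
case: p => v _ [w [y [X [/= -> CX Xy /infinite_gt1 gX]]]].
exact: (ends_neutral_Fwd CX Xy gX).
Qed.

(* By Zorn's lemma, finite exits can be added to [T] until none is left, and this
   never creates a path ending in an edge of an infinite block. *)
Lemma Omega_extend {G : sepGraph} (T : set (gpath G)) : FL T ->
  exists Z : Omega G, T `<=` Z /\ Z `&` infinite_edge_ended `<=` T.
Proof.
move=> [v _ FT].
(* [T] is kept apart from [W] so that [P] also holds for the union of the empty chain. *)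
pose P W := FL_at v (T `|` W) /\ W `&` infinite_edge_ended `<=` T.
have [F FP tF|A [[FA iA] maxA]] := @Zorn_bigcup _ P.
  split; first by apply: FL_at_setU_bigcup => // W /FP[].
  by move=> p [[W /FP[_ iW] Wp] ip]; apply: iW.
have FZ : FL (T `|` A) by exists v.
have finZ : NLfin (T `|` A) = set0.
  apply/seteqP; split=> // p /(exitsP _ _ FA)[g [u [y [X]]]].
  move=> [CX Xy [gX fX] -> ex].
  have /FL_atE[_ _ lA _ _] := FA.
  have nf := exit_notin lA ex; have [Zg nu _ [_ FU]] := ex.
  apply: (maxA (A `|` down [set (v, g ++ rcons u (Fwd y))])).
    split; first by left.
    move=> /(_ (v, g ++ rcons u (Fwd y))) h; apply: nf; right; apply: h.
    by right; exact/down1/pprefix_refl.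
  split; first by rewrite setUA.
  (* Of the new paths, those with neutral end are not of the excluded form, and the exit itself ends
     in the finite block [X]. *)
  move=> q [[Aq|[_ -> /(exit_prefix nu)[qg|nq|Eq]]] iq]; first exact: iA.
  - by have [//|Aq] := lA _ _ Zg qg; exact: iA.
  - by have := infinite_edge_ended_neutral iq.
  - exfalso; case: iq => w [z [Y [E CY Yz]]]; apply.
    move: E; rewrite Eq /= -rcons_cat => /rcons_inj[_ [Eyz]]; subst z.
    by rewrite (block_uniq CY CX Yz Xy).
exists (MkOmega FZ finZ); split=> [p|p [[//|Ap] ip]]; first by left.
exact: iA.
Qed.

(** * Isolated points and trees without exits *)

Lemma isolatedE {G : sepGraph} (Z : Omega G) : isolated [set: Omega G] Z <->
  exists2 i, Omega_index i & Omega_basic i = [set Z].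
Proof.
split=> [[_ [V]]|[i ii Ei]].
- rewrite nbhsE setIT => -[B [/open_OmegaE[D sD <-] [i Di iZ]] BV] EV.
  exists i; first exact: sD.
  apply/seteqP; split=> [Y iY|_ -> //].
  by rewrite -EV; apply: BV; exists i.
- split; first by rewrite in_setT.
  exists (Omega_basic i); last by rewrite setIT.
  apply: open_nbhs_nbhs; split; last by rewrite Ei.
  apply/open_OmegaE; exists [set i]; first by move=> _ ->.
  by rewrite bigcup_set1.
Qed.

Lemma tree_no_exits {G : sepGraph} (v : vertex G) T : FL_at v T ->
  (forall g u y X, Cblock X -> X y -> gt1 X -> ~ exit_at v T g u y) <->
  no_exits T.
Proof.
move=> FT; split=> [h|[ni nf] g u y X CX Xy gX ex].
- split; apply/seteqP; split=> // p /(exitsP _ _ FT)[g [u [y [X]]]].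
  + by move=> [CX Xy iX _]; apply: (h g u y X) => //; exact: infinite_gt1 iX.
  + by move=> [CX Xy [gX _] _]; exact: (h g u y X).
- have [fX|iX] := pselect (finite_set X).
  + suff : NLfin T (v, g ++ rcons u (Fwd y)) by rewrite nf.
    by apply/(exitsP _ _ FT); exists g, u, y, X.
  + suff : NLinf T (v, g ++ rcons u (Fwd y)) by rewrite ni.
    by apply/(exitsP _ _ FT); exists g, u, y, X.
Qed.

Lemma Omega_eq {G : sepGraph} (Y Z : Omega G) :
  omega_set Y = omega_set Z -> Y = Z.
Proof.
case: Y Z => [Y fY nY] [Z fZ nZ] /= E; case: Z / E fZ nZ => fZ nZ.
by rewrite (Prop_irrelevance fY fZ) (Prop_irrelevance nY nZ).
Qed.

Lemma isolated_OmegaIso {G : sepGraph} (Z : Omega G) :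
  isolated [set: Omega G] Z <-> OmegaIso G Z.
Proof.
split.
- move=> /isolatedE[[T F] [/= [[v _ FT] fT] fF FN] E].
  have [TZ FZ] : Omega_basic (T, F) Z by rewrite E.
  have uniqZ (Y : Omega G) : T `<=` Y -> F `&` Y = set0 -> Y = Z.
    by move=> TY FY; have : Omega_basic (T, F) Y by []; rewrite E.
  have /FL_atE[Tv _ lT _ _] := FT.
  (* If [T] had an exit with last edge in [X], two of its siblings outside [F] would both be forced
     into [Z]. *)
  have nT : no_exits T.
    apply/(tree_no_exits FT) => g u y X CX Xy gX ex.
    pose s z := (v, g ++ rcons u (Fwd z)).
    have s_inj : injective s.
      by move=> z z'; rewrite /s -!rcons_cat => /(congr1 snd) /= /rcons_inj[->].
    have Fi p : F p -> infinite_edge_ended p.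
      move=> /FN/(exitsP _ _ FT)[g1 [u1 [z [Y [CY Yz iY -> _]]]]].
      by exists (g1 ++ u1), z, Y; split=> //=; rewrite rcons_cat.
    have nF p : F p -> ~ T p.
      move=> /FN/(exitsP _ _ FT)[g1 [u1 [z [Y [_ _ _ -> ex1]]]]].
      exact: exit_notin ex1.
    have fFs : finite_set (s @^-1` F) by apply: finite_preimage => // ? ? _ _ /s_inj.
    (* For finite [X] no sibling lies in [F], whose paths end in edges of infinite blocks; for
       infinite [X] the finite set [F] excludes only finitely many edges. *)
    have [a [b [[Xa Fa] [Xb Fb] ab]]] : gt1 (X `\` s @^-1` F).
      have [fX|iX] := pselect (finite_set X).
        have [a [b [Xa Xb ab]]] := gX.
        have sF z : X z -> ~ F (s z).
          move=> Xz /Fi[w [y' [Y [/=]]]]; rewrite -rcons_cat => /rcons_inj[_ [<-]].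
          by move=> CY Yz; apply; rewrite (block_uniq CY CX Yz Xz).
        by exists a, b; split=> //; split=> //; exact: sF.
      exact/infinite_gt1/infinite_setD.
    have ext z : X z -> ~ F (s z) -> omega_set Z (s z).
      move=> Xz Fz; have exz := exit_sibling FT CX gX Xy Xz ex.
      have [Tg nu _ [_ FU]] := exz.
      (* The extension [Y] gains no further path ending in an infinite block, so it avoids [F] and
         equals [Z] by [uniqZ]. *)
      have [|Y [UY iY]] := @Omega_extend G (T `|` down [set s z]); first by exists v.
      have Ys : omega_set Y (s z) by apply: UY; right; exact/down1/pprefix_refl.
      suff <- : Y = Z by [].
      apply: uniqZ => [p Tp|]; first by apply: UY; left.
      apply/seteqP; split=> // p [Fp Yp].
      have [Tp|[_ -> /(exit_prefix nu)[pg|np|Ep]]] : (T `|` down [set s z]) p.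
      - by apply: iY; split=> //; exact: Fi.
      - exact: nF Tp.
      - by apply: (nF p) => //; exact: lT pg.
      - exact: infinite_edge_ended_neutral (Fi _ Fp) np.
      - by apply: Fz; rewrite /s -Ep.
    have /FL_atE[_ _ _ fZ _] : FL_at v Z.
      by apply: (FL_at_FL (p := (v, [::])) (omega_FL Z)) => //; exact: TZ.
    apply: ab; apply: (fZ (g ++ u) X) => //; rewrite rcons_cat; exact: ext.
  have FT' : FL T by exists v.
  (* Without finite exits [T] is itself a point, and without infinite exits [F] is empty. *)
  have -> : omega_set Z = T.
    suff <- : MkOmega FT' (proj2 nT) = Z by [].
    apply: uniqZ => //=; apply/seteqP; split=> // p [/FN].
    by rewrite (proj1 nT).
  by [].
- move=> [[[v _ FZ] fZ] nZ]; apply/isolatedE.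
  (* Another point of this basic set would properly contain [Z] and hence yield an exit of [Z]. *)
  exists (omega_set Z, set0).
    by split=> //=; split=> //; exists v.
  apply/seteqP; split=> [Y [/= ZY _]|_ ->]; last by split=> //=; rewrite set0I.
  apply: Omega_eq.
  apply/seteqP; split=> // p Yp; apply: contrapT => nZp.
  have /FL_atE[Zv _ _ _ _] := FZ.
  have FY : FL_at v Y.
    by apply: (FL_at_FL (p := (v, [::])) (omega_FL Y)) => //; exact: ZY.
  have [g [u [y [X [CX Xy gX ex]]]]] := exit_exists FZ FY ZY Yp nZp.
  exact: (proj2 (tree_no_exits FZ) nZ g u y X).
Qed.

(** * Isotropy and conjugates of cycles *)

(** A prefix of p^-1 cancels the matching suffix of [p]. This identifies the two formulas for the
    partial action. *)
Lemma pmul_down_pinv {G : sepGraph} (p : gpath G) : reduced p.2 ->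
  pmul p @` down [set pinv p] = down [set p].
Proof.
case: p => v w /= rw; apply/seteqP; split.
- move=> _ [[x q] [_ -> /pprefixP[z [_ /= E]]] <-].
  exists (v, w) => //; apply/pprefixP; exists (winv q).
  have Ew : w = winv z ++ winv q by rewrite -winv_cat -E winvK.
  have rz : reduced (winv z).
    by move=> a /(consecutive_catl (winv q)); rewrite -Ew; exact: rw.
  have -> : pmul (v, w) (x, q) = (v, reduce (winv z ++ winv q ++ q ++ [::])).
    by rewrite /pmul /= Ew -catA cats0.
  by rewrite reduce_catV cats0 reduce_id // Ew.
- move=> [x u] [_ -> /pprefixP[z [-> /= E]]].
  have ru : reduced u.
    by move=> a /(consecutive_catl z); rewrite -E; exact: rw.
  exists (prng (x, w), winv z).
    by apply/down1/pprefixP; exists (winv u); rewrite /pinv E winv_cat.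
  have -> : pmul (x, w) (prng (x, w), winv z) =
      (x, reduce (u ++ winv (winv z) ++ winv z ++ [::])).
    by rewrite /pmul /= E winvK cats0 catA.
  by rewrite reduce_catV cats0 reduce_id.
Qed.

(** The outer letters are stripped as long as they are mutually inverse. *)
Lemma cyclic_reduction {G : sepGraph} (w : seq (letter G)) :
  reduced w -> w <> [::] -> exists b c,
    [/\ w = b ++ c ++ winv b, c <> [::] &
      forall a c1 z c2, c = a :: c1 -> c = rcons c2 z -> a <> linv z].
Proof.
elim: {w}(size w).+1 {-2}w (ltnSn (size w)) => // n IH [//|a w] sw rw _.
have [[w' Ew]|nw] := pselect (exists w', w = rcons w' (linv a)); last first.
  exists [::], (a :: w); split=> //; first by rewrite /= cats0.
  (* A one-letter [c] is covered too, since no letter is its own inverse. *)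
  move=> a' c1 z c2 [<- _] {a' c1}; case: c2 => [|a' c2] /= [Ea].
    by rewrite Ea; case: z {Ea} => ?.
  by move=> Ew Eaz; apply: nw; exists c2; rewrite Eaz linvK.
(* Reducedness excludes the word a a^-1, so the middle is never exhausted. *)
subst w; have w'0 : w' <> [::].
  by move=> w'0; apply: (rw a); exists [::], [::]; rewrite w'0.
have rw' : reduced w'.
  move=> b /(consecutive_catl [:: linv a]) /(consecutive_catr [:: a]).
  by rewrite cats1; exact: rw.
have [|b [c [Ew c0 h]]] := IH w' _ rw' w'0.
  by move: sw; rewrite /= size_rcons !ltnS => /ltnW.
by exists (a :: b), c; split=> //; rewrite Ew winv_cons -cats1 /= -!cats1 -!catA.
Qed.

(** The neutral suffix removed by [Lword] cannot reach past [a]. *)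
Lemma Lword_cat_nonneutral {G : sepGraph} (b : seq (letter G)) a w :
  ~ neutral a -> exists z, Lword (b ++ a :: w) = b ++ a :: z.
Proof.
move=> na; elim: b => [|c b [z E]] /=.
  by rewrite asboolF // andbF; exists (Lword w).
by rewrite E; exists z; case: b {E}.
Qed.

(** Brings isotropy into the form of the condition in [OmegaIso0]. *)
Lemma isotropyE {G : sepGraph} (Z : Omega G) (v : vertex G) w (rw : reduced w) :
  w <> [::] -> walk v w ->
  isotropy Z (FreeGroup rw) <->
  Csep (v, w) /\ omega_set Z (pL (pinv (v, w))) /\
    setL ((pmul (v, w) @` Z) `|` down [set (v, w)]) = Z.
Proof.
case: w rw => // a w rw _ [<- _].
rewrite /isotropy /theta_dom /theta /= image_setU pmul_down_pinv //.
by split=> [[[]]|[? []]].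
Qed.

(* If [w] is conjugate to [c] by [b] and [c] starts with [y] and ends with the
   inverse of [x], then [b y] and [b x] are prefixes of [w]_L and of [w^-1]_L;
   for [x <> y] in one block they would not be compatible. *)
Lemma conjugate_of_cycle {G : sepGraph} (v : vertex G) Z w : FL_at v Z ->
  closed_path (v, w) -> Z (pL (v, w)) -> Z (pL (pinv (v, w))) ->
  exists beta gamma, [/\ cycle_path gamma, is_path beta /\ prng beta = gamma.1 &
    (v, w) = pcat (pcat beta gamma) (pinv beta)].
Proof.
move=> /FL_atE[_ _ lZ fZ _] [/= w0 sw pw] Zw Zw'.
have [_ /= rw _] := sw.
have [b [c [Ew c0 cyc]]] := cyclic_reduction rw w0.
subst w; have [/walk_cat[wb /walk_cat[wc wb']] _ _] := sw.
rewrite /= in wb wc wb'.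
have sc : Csep (prng (v, b), c) by apply: Csep_prefix (Csep_suffix sw).
(* As b^-1 leads from r(c) back to [v], reading [b] from [v] ends at r(c). *)
have rc : prng (prng (v, b), c) = prng (v, b).
  have Eb : prng (prng (prng (v, b), c), winv b) = v by rewrite -!prng_cat.
  by have [_] := walk_winv wb'; rewrite winvK Eb.
exists (v, b), (prng (v, b), c); split=> //; last first.
  by rewrite /pcat /pinv /= catA.
split=> //; apply: Csep_cat => //; first by rewrite rc.
move=> c2 z a c1 /= Ez Ea; split; first exact: cyc Ea Ez.
move=> X x y CX Xx Xy zx ay; subst z a.
have xy : x <> y by move=> xy; apply: (cyc _ _ _ _ Ea Ez); rewrite xy.
have gX : gt1 X by exists x, y.
have prefixb t d u : X t -> d = Fwd t :: u ->
    Z (v, Lword (b ++ d ++ winv b)) -> Z (v, rcons b (Fwd t)).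
  move=> Xt -> Zt; have nt := block_not_neutral CX Xt gX.
  have [z E] := Lword_cat_nonneutral b (u ++ winv b) nt.
  rewrite cat_cons E in Zt; apply: (lZ _ _ Zt); apply/pprefixP.
  by exists z; rewrite cat_rcons.
apply: xy; apply: (fZ b X) => //.
(* In w^-1 = b c^-1 b^-1, the letter after [b] is the inverse of the last letter [Bwd x] of [c]. *)
- apply: (prefixb x (winv c) (winv c2)) => //; first by rewrite Ez winv_rcons.
  by move: Zw'; rewrite /pL /= pw !winv_cat winvK -catA.
- exact: (prefixb y c c1).
Qed.

Lemma isotropy_trivialE {G : sepGraph} (Z : Omega G) :
  isotropy Z = [set 1%g] <->
  ~ exists alpha beta gamma : gpath G,
      [/\ closed_path alpha, cycle_path gamma,
          is_path beta /\ prng beta = gamma.1,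
          alpha = pcat (pcat beta gamma) (pinv beta) &
          omega_set Z (pL (pinv alpha)) /\
          setL ((pmul alpha @` Z) `|` down [set alpha]) = Z].
Proof.
split.
- move=> iZ [[v w] [beta [gamma [[/= w0 sw pw] _ _ _ ZE]]]].
  have [/= wk rw _] := sw.
  have : isotropy Z (FreeGroup rw) by apply/(isotropyE Z rw w0 wk).
  by rewrite iZ => /(congr1 (@fword G)).
- move=> h; apply/seteqP; split=> [[w rw] iw|_ ->]; last by split.
  apply: contrapT => w1; apply: h.
  have w0 : w <> [::] by move=> w0; apply: w1; apply: freeGroup_eq.
  have [v [sw [Zw EZ]]] : exists v, Csep (v, w) /\
      omega_set Z (pL (pinv (v, w))) /\
      setL ((pmul (v, w) @` Z) `|` down [set (v, w)]) = Z.
    have [v wk] : exists v, walk v w.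
      by case: w rw iw w0 w1 => // a w rw [[[wk _ _] _] _] _ _; exists (lsrc a).
    by exists v; apply/(isotropyE Z rw w0 wk).
  (* The translate always contains [pL (v, w)], and here it equals [Z]. *)
  have Zw' : omega_set Z (pL (v, w)).
    rewrite -EZ; exists (pL (v, w)); last exact: pprefix_refl.
    by exists (v, w) => //; right; exact/down1/pprefix_refl.
  have FZ : FL_at v Z by apply: FL_at_FL (omega_FL Z) Zw' _.
  (* The path [pinv (v, w)] starts at r(w), and all paths of [Z] start at [v]. *)
  have pw : prng (v, w) = v.
    by have /FL_atE[_ sZ _ _ _] := FZ; have [] := sZ _ Zw.
  have cw : closed_path (v, w) by [].
  have [beta [gamma [cg pb E]]] := conjugate_of_cycle FZ cw Zw' Zw.
  by exists (v, w), beta, gamma.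
Qed.

Theorem proposition8p8 (G : sepGraph) :
  [set omega_set Z | Z in isolated [set: Omega G]] = OmegaIso G /\
  OmegaIso0 G =
    [set omega_set Z | Z in
      [set Z : Omega G |
        isolated [set: Omega G] Z /\ isotropy Z = [set 1%g]]].
Proof.
have iso : [set omega_set Z | Z in isolated [set: Omega G]] = OmegaIso G.
  apply/seteqP; split=> [_ [Z /isolated_OmegaIso iZ <-] //|T iT].
  have [[FT _] [_ nT]] := iT; exists (MkOmega FT nT) => //.
  exact/isolated_OmegaIso.
split=> //; apply/seteqP; split=> [T [iT nT]|_ [Z [iZ /isotropy_trivialE nZ] <-]].
- have [Z iZ E] : [set omega_set Z | Z in isolated [set: Omega G]] T by rewrite iso.
  subst T; exists Z => //; split=> //.
  exact/isotropy_trivialE.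
- by split=> //; exact/isolated_OmegaIso.
Qed.
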